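(* Let $\mathbb{F}_q$ be a finite field and $\lambda$ a tuple of positive integers with sum $n$. All eigenvalues of the Radon transform $\mathcal{R}$ on $\mathbb{C}[GL_n(\mathbb{F}_q)/U_\lambda]$ are real.
   Context: $U_\lambda\subset GL_n(\mathbb{F}_q)$ is the group of block upper triangular matrices whose diagonal blocks are identity matrices of sizes given by $\lambda$, and $U_\lambda^{op}$ is the group of transposes. For a subgroup $H$ of a finite group $G$, $e_H=\frac{1}{|H|}\sum_{h\in H}h\in\mathbb{C}[G]$ and $\mathbb{C}[G/H]=\mathbb{C}[G]e_H$ is the space of right $H$-invariant elements of $\mathbb{C}[G]$. The Radon transform is the operator on $\mathbb{C}[GL_n(\mathbb{F}_q)/U_\lambda]$ of right multiplication by $\mathcal{R}=|U_\lambda|^2e_{U_\lambda}e_{U_\lambda^{op}}e_{U_\lambda}$. *)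

(* Defs.v *)
From HB Require Import structures.
From mathcomp Require Import all_boot all_order all_fingroup all_algebra all_field.
From mathcomp Require Export complex.
From mathcomp Require Export reals.

Set Implicit Arguments.
Unset Strict Implicit.
Unset Printing Implicit Defensive.

Import GRing.Theory.

Local Open Scope ring_scope.

(* The group algebra K[G] of the whole finite group gT.  It is an alias of    *)
(* {ffun gT -> K} so that the product is the convolution, not the pointwise   *)
(* product.                                                                   *)
Definition group_alg (K : fieldType) (gT : finGroupType) : Type :=
  {ffun gT -> K^o}.

Section GroupAlgebra.

Variables (K : fieldType) (gT : finGroupType).

Local Notation A := (group_alg K gT).

HB.instance Definition _ := Vector.copy A {ffun gT -> K^o}.

Implicit Types (x y z : A) (g h : gT).

Definition ga_elt g : A := [ffun h => (h == g)%:R].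

Definition ga_mul x y : A := [ffun g => \sum_h x h * y (h^-1 * g)%g].

Fact ga_mulA : associative ga_mul.
Proof.
move=> x y z; apply/ffunP=> g; rewrite !ffunE.
under eq_bigr do rewrite ffunE mulr_sumr.
under [RHS]eq_bigr do rewrite ffunE mulr_suml.
rewrite [RHS]exchange_big /=; apply: eq_bigr => h _.
rewrite [RHS](reindex_inj (mulgI h)) /=; apply: eq_bigr => k _.
by rewrite mulKg invMg mulgA mulrA.
Qed.

Fact ga_mul1l : left_id (ga_elt 1%g) ga_mul.
Proof.
move=> x; apply/ffunP=> g; rewrite ffunE (bigD1 1%g) //= ffunE eqxx mul1r.
rewrite invg1 mul1g big1 ?addr0 // => h /negPf hn1.
by rewrite ffunE hn1 mul0r.
Qed.

Fact ga_mul1r : right_id (ga_elt 1%g) ga_mul.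
Proof.
move=> x; apply/ffunP=> g; rewrite ffunE (bigD1 g) //= ffunE mulVg eqxx mulr1.
rewrite big1 ?addr0 // => h hng.
by rewrite ffunE -eq_mulVg1 (negPf hng) mulr0.
Qed.

Fact ga_mulDl : left_distributive ga_mul +%R.
Proof.
move=> x y z; apply/ffunP=> g; rewrite !ffunE -big_split /=.
by apply: eq_bigr => h _; rewrite ffunE mulrDl.
Qed.

Fact ga_mulDr : right_distributive ga_mul +%R.
Proof.
move=> x y z; apply/ffunP=> g; rewrite !ffunE -big_split /=.
by apply: eq_bigr => h _; rewrite ffunE mulrDr.
Qed.

Fact ga_1neq0 : ga_elt 1%g != 0 :> A.
Proof.
by apply/eqP=> /ffunP/(_ 1%g); rewrite !ffunE eqxx; apply/eqP/oner_neq0.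
Qed.

HB.instance Definition _ := GRing.Zmodule_isNzRing.Build A
  ga_mulA ga_mul1l ga_mul1r ga_mulDl ga_mulDr ga_1neq0.

Fact ga_scaleAl (a : K) x y : a *: (x * y) = a *: x * y.
Proof.
apply/ffunP=> g; rewrite !ffunE scaler_sumr.
by apply: eq_bigr => h _; rewrite ffunE scalerAl.
Qed.

HB.instance Definition _ := GRing.Lmodule_isLalgebra.Build K A ga_scaleAl.

Fact ga_scaleAr (a : K) x y : a *: (x * y) = x * (a *: y).
Proof.
apply/ffunP=> g; rewrite !ffunE scaler_sumr.
by apply: eq_bigr => h _; rewrite ffunE scalerAr.
Qed.

HB.instance Definition _ := GRing.Lalgebra_isAlgebra.Build K A ga_scaleAr.

HB.instance Definition _ := Algebra_isFalgebra.Build K A.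

Definition idem (H : {group gT}) : A := (#|H|%:R)^-1 *: \sum_(h in H) ga_elt h.

(* K[G/H] = K[G] e_H *)
Definition coset_space (H : {group gT}) : {vspace A} :=
  (amulr (idem H) @: fullv)%VS.

Lemma ga_eltM g h : ga_elt (g * h)%g = ga_elt g * ga_elt h.
Proof.
apply/ffunP=> k; rewrite !ffunE (bigD1 g) //= !ffunE eqxx mul1r.
rewrite big1 ?addr0 => [|l /negPf lng]; last by rewrite ffunE lng mul0r.
by rewrite (can2_eq (mulKVg g) (mulKg g)).
Qed.

Lemma idem_mulr (H : {group gT}) h : h \in H -> idem H * ga_elt h = idem H.
Proof.
move=> Hh; rewrite -scalerAl mulr_suml; congr (_ *: _).
rewrite [RHS](reindex_inj (mulIg h)) /=.
by apply: eq_big => [k|k _]; rewrite ?groupMr ?ga_eltM.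
Qed.

Lemma coset_spaceP (H : {group gT}) x :
    #|H|%:R != 0 :> K ->
  reflect (forall h, h \in H -> x * ga_elt h = x) (x \in coset_space H).
Proof.
move=> nzH; apply: (iffP memv_imgP) => [[y _ ->] h Hh | xH].
  by rewrite lfunE /= -mulrA idem_mulr.
exists x; rewrite ?memvf // lfunE /= -scalerAr mulr_sumr.
by rewrite (eq_bigr (fun=> x)) // sumr_const -scaler_nat scalerA mulVf ?scale1r.
Qed.

End GroupAlgebra.

Section Radon.

Variables (F : finFieldType) (n : nat) (lam : seq nat).

(* Row and column i lie in the diagonal block of index reshape_index lam i.   *)
Definition U_set : {set {'GL_n[F]}} :=
  [set g : {'GL_n[F]} | [forall i : 'I_n.-1.+1, forall j : 'I_n.-1.+1,
     (reshape_index lam j <= reshape_index lam i)%N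
       ==> (GLval g i j == (i == j)%:R)]].

Lemma U_setP (g : {'GL_n[F]}) :
  reflect (forall i j : 'I_n.-1.+1, (reshape_index lam j <= reshape_index lam i)%N ->
             GLval g i j = (i == j)%:R)
          (g \in U_set).
Proof.
rewrite inE; apply: (iffP forallP) => [gU i j le_ji | gU i].
  by have /forallP/(_ j)/implyP/(_ le_ji)/eqP := gU i.
by apply/forallP=> j; apply/implyP=> le_ji; apply/eqP/gU.
Qed.

Fact U_group_set : group_set U_set.
Proof.
apply/group_setP; split=> [|g h /U_setP gU /U_setP hU]; apply/U_setP=> i j le_ji.
  by rewrite GL_1E mxE.
rewrite GL_MxE mxE (bigD1 i) //= gU // eqxx mul1r hU // big1 ?addr0 // => k nki.
case: (leqP (reshape_index lam k) (reshape_index lam i)) => [le_ki | lt_ik].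
  by rewrite gU // eq_sym (negPf nki) mul0r.
rewrite [GLval h k j]hU ?(leq_trans le_ji (ltnW lt_ik)) //.
by case: eqP lt_ik => [-> | _ _]; rewrite ?ltnNge ?le_ji ?mulr0.
Qed.

Canonical U_group := Group U_group_set.

Fact GLtr_subproof (g : {'GL_n[F]}) : (GLval g)^T \in unitmx.
Proof. by rewrite unitmx_tr; apply: GL_unitmx. Qed.

Definition GLtr (g : {'GL_n[F]}) : {'GL_n[F]} :=
  FinRing.unit _ (GLtr_subproof g).

Lemma GLtrM (g h : {'GL_n[F]}) : GLtr (g * h)%g = (GLtr h * GLtr g)%g.
Proof. by apply/val_inj; rewrite /= trmx_mul. Qed.

Definition Uop_set : {set {'GL_n[F]}} := GLtr @: U_set.

Fact Uop_group_set : group_set Uop_set.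
Proof.
apply/group_setP; split=> [|_ _ /imsetP[g gU ->] /imsetP[h hU ->]].
  apply/imsetP; exists 1%g; first exact: (group1 U_group).
  by apply/val_inj; rewrite /= trmx1.
by rewrite -GLtrM imset_f //; apply: (groupM (G := U_group)).
Qed.

Canonical Uop_group := Group Uop_group_set.

Variable K : fieldType.

Definition radon_elt : group_alg K {'GL_n[F]} :=
  (#|U_set|%:R ^+ 2) *: (idem K U_group * idem K Uop_group * idem K U_group).

(* vsproj only serves to land in the subtype: K[G/U] is stable under right    *)
(* multiplication by radon_elt, see radonE.                                   *)
Definition radon : 'End(subvs_of (coset_space K U_group)) :=
  (linfun (vsproj (coset_space K U_group)) \o amulr radon_elt
     \o linfun vsval)%VF.

Lemma radonE v : vsval (radon v) = vsval v * radon_elt.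
Proof.
rewrite /radon comp_lfunE comp_lfunE !lfunE /= vsprojK //; apply/memv_imgP.
exists (#|U_set|%:R ^+ 2 *: (vsval v * (idem K U_group * idem K Uop_group))).
  exact: memvf.
by rewrite lfunE /= /radon_elt -scalerAr -[RHS]scalerAl !mulrA.
Qed.

End Radon.

(* Main.v *)
Require Import Defs.
From mathcomp Require Import all_boot all_order all_fingroup all_algebra.

(** Let [z := e_U * e_Uop * e_U].  The Radon transform is right multiplication
    by a positive integer multiple of [z], and it is self-adjoint for the
    standard hermitian form <x, y> = sum_g x(g) conj(y(g)) of the group algebra.
    Indeed the adjoint of right multiplication by an element [w] is right
    multiplication by the element whose coefficient at g is conj(w(g^-1)); the
    averaging idempotent of a subgroup H is unchanged by this involution, since
    its coefficients are the rational number 1/|H| on H and zero elsewhere, and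
    H is closed under inversion ([idemV]), so right multiplication by
    it is self-adjoint ([ga_dot_idem]).
    A product of self-adjoint operators that reads the same in both directions
    is again self-adjoint, which is the case of [z] ([ga_dot_radon]).  The usual
    argument for self-adjoint operators concludes: if v is a nonzero eigenvector
    of eigenvalue a, then a <v, v> = conj(a) <v, v> with <v, v> <> 0. *)

Set Implicit Arguments.
Unset Strict Implicit.
Unset Printing Implicit Defensive.

Import GRing.Theory Num.Theory.

Local Open Scope ring_scope.

Section HermitianForm.

Variables (K : numClosedFieldType) (gT : finGroupType).
Implicit Types (x y z : group_alg K gT) (H : {group gT}) (c : K).

Definition ga_dot x y : K := \sum_g x g * (y g)^*.

Lemma ga_dotZl c x y : ga_dot (c *: x) y = c * ga_dot x y.
Proof. by rewrite mulr_sumr; apply: eq_bigr => g _; rewrite ffunE mulrA. Qed.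

Lemma ga_dotZr c x y : ga_dot x (c *: y) = c^* * ga_dot x y.
Proof.
by rewrite mulr_sumr; apply: eq_bigr => g _; rewrite ffunE rmorphM mulrCA.
Qed.

Lemma ga_dot_eq0 x : (ga_dot x x == 0) = (x == 0).
Proof.
apply/eqP/eqP => [x0|->]; last first.
  by rewrite /ga_dot big1 // => g _; rewrite ffunE mul0r.
have ge0 g : true -> 0 <= x g * (x g)^* by rewrite mul_conjC_ge0.
apply/ffunP=> g; rewrite ffunE; apply/eqP; rewrite -mul_conjC_eq0.
by apply/eqP; apply: (psumr_eq0P ge0 x0).
Qed.

(** Both sides expand to the sum of x(h) z(h^-1 g) conj(y(g)) over g and h, up
    to replacing z(h^-1 g) by conj(z(g^-1 h)); the hypothesis says that [z] is
    fixed by the involution of the group algebra. *)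
Lemma ga_dot_selfadjoint z : (forall g, z g^-1%g = (z g)^*) ->
  forall x y, ga_dot (x * z) y = ga_dot x (y * z).
Proof.
move=> zV x y; rewrite /ga_dot.
under eq_bigr do rewrite ffunE mulr_suml.
rewrite exchange_big /=; apply: eq_bigr => h _.
rewrite ffunE rmorph_sum mulr_sumr; apply: eq_bigr => g _.
by rewrite rmorphM /= -zV invMg invgK -mulrA [_^* * _]mulrC.
Qed.

Lemma idemE H g : idem K H g = (#|H|%:R)^-1 * (g \in H)%:R.
Proof.
rewrite ffunE sum_ffunE; congr (_ * _).
case: (boolP (g \in H)) => [Hg|nHg].
  rewrite (bigD1 g) //= ffunE eqxx big1 ?addr0 // => h /andP[_ ngh].
  by rewrite ffunE eq_sym (negPf ngh).
rewrite big1 // => h Hh; rewrite ffunE.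
by case: eqP nHg => // ->; rewrite Hh.
Qed.

Lemma idemV H g : idem K H g^-1%g = (idem K H g)^*.
Proof. by rewrite !idemE groupV rmorphM fmorphV !rmorph_nat. Qed.

Lemma ga_dot_idem H x y : ga_dot (x * idem K H) y = ga_dot x (y * idem K H).
Proof. exact/ga_dot_selfadjoint/idemV. Qed.

End HermitianForm.

Lemma ga_dot_radon (K : numClosedFieldType) (F : finFieldType) (n : nat)
    (lam : seq nat) (x y : group_alg K {'GL_n[F]}) :
  ga_dot (x * radon_elt F n lam K) y = ga_dot x (y * radon_elt F n lam K).
Proof.
rewrite /radon_elt -scalerAr -[y * _]scalerAr ga_dotZl ga_dotZr.
by rewrite rmorphXn rmorph_nat !mulrA !ga_dot_idem.
Qed.

Lemma leigenvalue_radon_real (K : numClosedFieldType) (F : finFieldType)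
    (n : nat) (lam : seq nat) (a : K) :
  passmx.leigenvalue (radon F n lam K) a -> a \is Num.real.
Proof.
rewrite /passmx.leigenvalue -vpick0; set v := vpick _ => nz_v.
have: v \in passmx.leigenspace (radon F n lam K) a by apply: memv_pick.
rewrite memv_ker add_lfunE opp_lfunE scale_lfunE id_lfunE subr_eq0.
move=> /eqP/(congr1 vsval); rewrite radonE linearZ /= => vz.
have nz_vv : ga_dot (vsval v) (vsval v) != 0.
  by rewrite ga_dot_eq0 (raddf_eq0 _ (@subvs_inj _ _ _)).
rewrite CrealE; apply/eqP/(mulIf nz_vv).
by rewrite -[RHS]ga_dotZl -vz ga_dot_radon vz ga_dotZr.
Qed.

Theorem corollary3p6 (R : realType) (F : finFieldType) (n k : nat)
    (lam : k.-tuple nat) (lam_gt0 : forall i, (0 < tnth lam i)%N)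
    (lam_sum : (\sum_i tnth lam i)%N = n) (a : R[i]) :
  passmx.leigenvalue (radon F n lam R[i]) a -> a \is Num.real.
Proof. exact: leigenvalue_radon_real. Qed.
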